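(* Let $\alpha,a\in\mathbb{R}$. For every integer $l\ge 0$, the polynomial $P_l=P_l^{(a,\alpha)}$ satisfies, for all $x\in\mathbb{R}$, $$\sigma(x)\frac{d^2 P_l(x)}{dx^2}+\tau(x)\frac{d P_l(x)}{dx}=-\lambda_l P_l(x),$$ where $\tau(x)=\alpha-\sigma'(x)(a+l)$ and $\lambda_l=l(2a+l+1)$.
   Context: Throughout $x$ is a real variable, $\alpha,a$ are real parameters, $\sigma(x)=1+x^2$, and $\cot^{-1}:\mathbb{R}\to(0,\pi)$ is the smooth branch, so that $\frac{d}{dx}\cot^{-1}x=-1/\sigma(x)$. For integers $l\ge 0$ put $w_l(x)=\sigma(x)^{-(l+a+1)}e^{-\alpha\cot^{-1}x}=\sigma(x)^{-l}w_0(x)$. The polynomials $P_l^{(a,\alpha)}$ are defined by the Rodrigues formula $P_l^{(a,\alpha)}(x)=\frac{1}{w_l(x)}\frac{d^l}{dx^l}[w_l(x)\sigma(x)^l]=\frac{\sigma(x)^l}{w_0(x)}\frac{d^l w_0(x)}{dx^l}$, $l=0,1,\ldots$. *)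

(* Defs.v *)
From Stdlib Require Import Reals Lra.
From Coquelicot Require Import Coquelicot.
Open Scope R_scope.

Definition sigma_poly (x : R) : R := 1 + x ^ 2.

(* The branch of the inverse cotangent that is smooth on R with values in
   (0, PI); [acot_bound], [cot_acot] and [is_derive_acot] confirm this. *)
Definition acot (x : R) : R := PI / 2 - atan x.

Lemma acot_bound (x : R) : 0 < acot x < PI.
Proof. unfold acot. generalize (atan_bound x). lra. Qed.

Lemma cot_acot (x : R) : cos (acot x) / sin (acot x) = x.
Proof.
unfold acot. rewrite sin_shift, cos_shift.
exact (tan_atan x).
Qed.

Lemma is_derive_acot (x : R) : is_derive acot x (- 1 / sigma_poly x).
Proof.
assert (Hs : 1 + x ^ 2 <> 0) by (generalize (pow2_ge_0 x); lra).
unfold acot, sigma_poly.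
evar_last.
- apply (is_derive_minus (fun _ => PI / 2) atan x).
  + apply is_derive_const.
  + apply is_derive_Reals. apply derivable_pt_lim_atan.
- unfold minus, plus, opp, zero, Rsqr; simpl in *. field. lra.
Qed.

(* [Rpower] is the genuine real power here since [sigma_poly x > 0]. *)
Definition w (a alpha : R) (l : nat) (x : R) : R :=
  Rpower (sigma_poly x) (- (INR l + a + 1)) * exp (- alpha * acot x).

Definition P (a alpha : R) (l : nat) (x : R) : R :=
  / w a alpha l x * Derive_n (fun t => w a alpha l t * sigma_poly t ^ l) l x.

Definition is_polynomial (f : R -> R) : Prop :=
  exists (n : nat) (c : nat -> R),
    forall x : R, f x = sum_n (fun k => c k * x ^ k) n.

Definition tau (a alpha : R) (l : nat) (x : R) : R :=
  alpha - Derive sigma_poly x * (a + INR l).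

Definition lambda (a : R) (l : nat) : R :=
  INR l * (2 * a + INR l + 1).

(* Main.v *)
Require Import Defs.
From Stdlib Require Import Reals Lra Lia PeanoNat.
From Coquelicot Require Import Coquelicot.
Open Scope R_scope.

(** Write [w_0] for [w a alpha 0].  Since [w_l * sigma^l = w_0], the
    polynomial [P_l] is [sigma^l * w_0^(l) / w_0], and the Pearson equation
    [sigma * w_0' = (alpha - 2 (a + 1) x) * w_0] turns differentiation of
    [w_0^(n) = P_n * w_0 / sigma^n] into the raising relation

      [P_(n+1) = sigma * P_n' + (alpha - 2 (a + n + 1) x) * P_n].

    The heart of the matter is the companion lowering relation
    [P_n' = - lambda_n * P_(n-1)].  Together the two say that raising after
    lowering multiplies [P_n] by [- lambda_n], which is the differential
    equation.  They also eliminate the derivative from the raising relation,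
    leaving a three-term recurrence.

    The argument runs backwards along these lines: [rodrigues_poly] is defined
    by the three-term recurrence, so that being a polynomial is immediate
    ([is_polynomial_rodrigues_poly]); the lowering relation is proved by
    induction from the recurrence alone ([is_derive_rodrigues_poly]); with it,
    the recurrence becomes the raising relation, which identifies
    [rodrigues_poly] with [P] ([Derive_n_weight], [P_eq_rodrigues_poly]). *)

(** * Closure properties of polynomial functions *)

(** Padding with zero coefficients lets two polynomials of different degrees
    be written as sums of the same length. *)
Lemma is_polynomial_padded (f : R -> R) :
  is_polynomial f ->
  exists n : nat, forall m : nat, exists c : nat -> R,
    forall x : R, f x = sum_n (fun k => c k * x ^ k) (n + m).
Proof.
  intros [n [c Hc]]. exists n. intros m.
  exists (fun k => if Nat.leb k n then c k else 0).
  intros x. rewrite Hc. clear Hc. induction m as [|m IH].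
  - rewrite Nat.add_0_r. apply sum_n_ext_loc. intros k Hk.
    now rewrite (proj2 (Nat.leb_le k n) Hk).
  - rewrite Nat.add_succ_r, sum_Sn, <- IH.
    rewrite (proj2 (Nat.leb_gt (S (n + m)) n)) by lia.
    rewrite Rmult_0_l. symmetry.
    exact (plus_zero_r (G := R_AbelianMonoid) _).
Qed.

Lemma is_polynomial_ext (f g : R -> R) :
  (forall x, f x = g x) -> is_polynomial f -> is_polynomial g.
Proof.
  intros Hfg [n [c Hc]]. exists n, c. intros x. now rewrite <- Hfg.
Qed.

Lemma is_polynomial_const (r : R) : is_polynomial (fun _ => r).
Proof.
  exists 0%nat, (fun _ => r). intros x. rewrite sum_O.
  change (r = r * 1). ring.
Qed.

Lemma is_polynomial_plus (f g : R -> R) :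
  is_polynomial f -> is_polynomial g -> is_polynomial (fun x => f x + g x).
Proof.
  intros Hf Hg.
  destruct (is_polynomial_padded f Hf) as [n Hn].
  destruct (is_polynomial_padded g Hg) as [m Hm].
  destruct (Hn m) as [c Hc]. destruct (Hm n) as [d Hd].
  exists (n + m)%nat, (fun k => c k + d k). intros x.
  rewrite Hc, Hd, (Nat.add_comm m n).
  rewrite <- (sum_n_plus (G := R_AbelianMonoid)).
  apply sum_n_ext. intros k.
  change (c k * x ^ k + d k * x ^ k = (c k + d k) * x ^ k). ring.
Qed.

Lemma is_polynomial_scal (r : R) (f : R -> R) :
  is_polynomial f -> is_polynomial (fun x => r * f x).
Proof.
  intros [n [c Hc]]. exists n, (fun k => r * c k). intros x.
  rewrite Hc, <- (sum_n_mult_l (K := R_Ring)).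
  apply sum_n_ext. intros k.
  change (r * (c k * x ^ k) = r * c k * x ^ k). ring.
Qed.

Lemma is_polynomial_mult_id (f : R -> R) :
  is_polynomial f -> is_polynomial (fun x => x * f x).
Proof.
  intros [n [c Hc]].
  exists (S n), (fun k => match k with O => 0 | S j => c j end). intros x.
  rewrite Hc, <- (sum_n_mult_l (K := R_Ring)). clear Hc.
  unfold sum_n. rewrite (sum_Sn_m _ 0 (S n)) by lia. rewrite <- sum_n_m_S.
  rewrite Rmult_0_l, (plus_zero_l (G := R_AbelianMonoid)).
  apply sum_n_m_ext. intros k.
  change (x * (c k * x ^ k) = c k * (x * x ^ k)). ring.
Qed.

(** * The three-term recurrence and the lowering relation *)

(** At [m = 0] the coefficient [lambda a 0] vanishes, so the value
    [Nat.pred 0 = 0] is harmless and a single formula also produces the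
    polynomial of degree one. *)
Fixpoint rodrigues_poly (a alpha : R) (n : nat) (x : R) : R :=
  match n with
  | O => 1
  | S m =>
      (alpha - 2 * (a + INR m + 1) * x) * rodrigues_poly a alpha m x
      - lambda a m * (sigma_poly x * rodrigues_poly a alpha (Nat.pred m) x)
  end.

Lemma rodrigues_poly_S (a alpha : R) (n : nat) (x : R) :
  rodrigues_poly a alpha (S n) x =
  (alpha - 2 * (a + INR n + 1) * x) * rodrigues_poly a alpha n x
  - lambda a n * (sigma_poly x * rodrigues_poly a alpha (Nat.pred n) x).
Proof. reflexivity. Qed.

Lemma lambda_0 (a : R) : lambda a 0 = 0.
Proof. unfold lambda. simpl. ring. Qed.

Lemma lambda_S (a : R) (n : nat) :
  lambda a (S n) = lambda a n + 2 * (a + INR n + 1).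
Proof. unfold lambda. rewrite S_INR. ring. Qed.

Lemma is_polynomial_rodrigues_poly (a alpha : R) (n : nat) :
  is_polynomial (rodrigues_poly a alpha n).
Proof.
  (* The recurrence has depth two, so consecutive pairs are carried along. *)
  cut (is_polynomial (rodrigues_poly a alpha n) /\
       is_polynomial (rodrigues_poly a alpha (Nat.pred n))).
  { tauto. }
  induction n as [|n [IHn IHp]].
  - split; exact (is_polynomial_const 1).
  - split; [|exact IHn].
    set (q := rodrigues_poly a alpha n) in *.
    set (p := rodrigues_poly a alpha (Nat.pred n)) in *.
    apply is_polynomial_ext with
      (fun x => (alpha * q x + - (2 * (a + INR n + 1)) * (x * q x))
                + - lambda a n * (p x + x * (x * p x))).
    + intros x. rewrite rodrigues_poly_S. fold q p. unfold sigma_poly. ring.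
    + repeat first [ assumption | apply is_polynomial_plus
                   | apply is_polynomial_scal | apply is_polynomial_mult_id ].
Qed.

Lemma is_derive_sigma_poly (x : R) : is_derive sigma_poly x (2 * x).
Proof. unfold sigma_poly. auto_derive; [easy | ring]. Qed.

(** The lowering relation.  Differentiating the recurrence for
    [rodrigues_poly (n + 1)] and applying the relation at [n] and at [n - 1]
    to the derivatives reproduces the recurrence for [rodrigues_poly n] with
    factor [- lambda_n]; the leftover [- 2 (a + n + 1) * rodrigues_poly n]
    accounts for the increment from [lambda_n] to [lambda_(n+1)]. *)
Lemma is_derive_rodrigues_poly (a alpha : R) (n : nat) (x : R) :
  is_derive (rodrigues_poly a alpha n) x
    (- lambda a n * rodrigues_poly a alpha (Nat.pred n) x).
Proof.
  revert x.
  cut ((forall x, is_derive (rodrigues_poly a alpha n) x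
          (- lambda a n * rodrigues_poly a alpha (Nat.pred n) x)) /\
       (forall x, is_derive (rodrigues_poly a alpha (Nat.pred n)) x
          (- lambda a (Nat.pred n)
           * rodrigues_poly a alpha (Nat.pred (Nat.pred n)) x))).
  { tauto. }
  assert (H0 : forall x, is_derive (rodrigues_poly a alpha 0) x
                 (- lambda a 0 * rodrigues_poly a alpha 0 x)).
  { intros x. rewrite lambda_0, Ropp_0, Rmult_0_l.
    exact (is_derive_const (1 : R) x). }
  induction n as [|n [IHn IHp]].
  - split; exact H0.
  - split; [|exact IHn].
    intros x.
    evar_last.
    + apply (is_derive_minus
        (fun t => (alpha - 2 * (a + INR n + 1) * t) * rodrigues_poly a alpha n t)
        (fun t => lambda a n
                  * (sigma_poly t * rodrigues_poly a alpha (Nat.pred n) t))).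
      * apply (is_derive_mult (fun t => alpha - 2 * (a + INR n + 1) * t)).
        -- instantiate (1 := - (2 * (a + INR n + 1))).
           auto_derive; [easy | ring].
        -- apply IHn.
        -- exact Rmult_comm.
      * apply (is_derive_scal
          (fun t => sigma_poly t * rodrigues_poly a alpha (Nat.pred n) t)).
        apply (is_derive_mult sigma_poly).
        -- apply is_derive_sigma_poly.
        -- apply IHp.
        -- exact Rmult_comm.
    + rewrite lambda_S. unfold minus, plus, opp, mult; simpl.
      destruct n as [|n].
      * rewrite !lambda_0. simpl. ring.
      * simpl Nat.pred. rewrite (rodrigues_poly_S a alpha n), lambda_S, S_INR. ring.
Qed.

(** * Identification with the Rodrigues formula *)

Lemma sigma_poly_pos (x : R) : 0 < sigma_poly x.
Proof. unfold sigma_poly. generalize (pow2_ge_0 x). lra. Qed.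

Lemma w_pos (a alpha : R) (l : nat) (x : R) : 0 < w a alpha l x.
Proof. apply Rmult_lt_0_compat; apply exp_pos. Qed.

Lemma w_mult_sigma_pow (a alpha : R) (l : nat) (x : R) :
  w a alpha l x * sigma_poly x ^ l = w a alpha 0 x.
Proof.
  unfold w. rewrite <- (Rpower_pow l _ (sigma_poly_pos x)).
  replace (- (INR 0 + a + 1)) with (- (INR l + a + 1) + INR l) by (simpl; ring).
  rewrite Rpower_plus. ring.
Qed.

(** The Pearson equation of the weight. *)
Lemma is_derive_weight (a alpha : R) (x : R) :
  is_derive (w a alpha 0) x
    ((alpha - 2 * (a + 1) * x) / sigma_poly x * w a alpha 0 x).
Proof.
  assert (Hs := sigma_poly_pos x).
  unfold w, Rpower.
  evar_last.
  - apply (is_derive_mult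
      (fun t => exp (- (INR 0 + a + 1) * ln (sigma_poly t)))
      (fun t => exp (- alpha * acot t))).
    + apply (is_derive_comp exp (fun t => - (INR 0 + a + 1) * ln (sigma_poly t))).
      * apply is_derive_exp.
      * apply (is_derive_scal (fun t => ln (sigma_poly t))).
        apply (is_derive_comp ln sigma_poly).
        -- apply is_derive_ln, Hs.
        -- apply is_derive_sigma_poly.
    + apply (is_derive_comp exp (fun t => - alpha * acot t)).
      * apply is_derive_exp.
      * apply (is_derive_scal acot). apply is_derive_acot.
    + exact Rmult_comm.
  - unfold plus, mult, scal; simpl; unfold mult; simpl. field. lra.
Qed.

Lemma is_derive_inv_sigma_pow (n : nat) (x : R) :
  is_derive (fun t => / sigma_poly t ^ n) x
    (- (INR n * (2 * x)) / sigma_poly x ^ S n).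
Proof.
  assert (Hs := sigma_poly_pos x).
  assert (Hn : sigma_poly x ^ n <> 0) by (apply pow_nonzero; lra).
  evar_last.
  - apply (is_derive_inv (fun t => sigma_poly t ^ n)).
    + apply (is_derive_pow sigma_poly), is_derive_sigma_poly.
    + exact Hn.
  - destruct n as [|n]; simpl in *.
    + field. lra.
    + field. split; [apply pow_nonzero|]; lra.
Qed.

(** The lowering relation rewrites the last term of the recurrence as
    [sigma * rodrigues_poly n'], so the recurrence is exactly the rule that
    differentiation induces on the numerator of [w_0^(n)]. *)
Lemma Derive_n_weight (a alpha : R) (n : nat) (x : R) :
  Derive_n (w a alpha 0) n x =
  rodrigues_poly a alpha n x * / sigma_poly x ^ n * w a alpha 0 x.
Proof.
  revert x. induction n as [|n IH]; intros x.
  - simpl. field.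
  - simpl Derive_n. rewrite (Derive_ext _ _ _ IH).
    apply is_derive_unique. assert (Hs := sigma_poly_pos x).
    evar_last.
    + apply (is_derive_mult
        (fun t => rodrigues_poly a alpha n t * / sigma_poly t ^ n)
        (w a alpha 0)).
      * apply (is_derive_mult (rodrigues_poly a alpha n)
                 (fun t => / sigma_poly t ^ n)).
        -- apply is_derive_rodrigues_poly.
        -- apply is_derive_inv_sigma_pow.
        -- exact Rmult_comm.
      * apply is_derive_weight.
      * exact Rmult_comm.
    + rewrite rodrigues_poly_S. unfold plus, mult; simpl.
      field. split; [apply pow_nonzero|]; lra.
Qed.

Lemma P_eq_rodrigues_poly (a alpha : R) (l : nat) (x : R) :
  P a alpha l x = rodrigues_poly a alpha l x.
Proof.
  unfold P.
  rewrite (Derive_n_ext _ _ _ _ (w_mult_sigma_pow a alpha l)), Derive_n_weight.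
  rewrite <- (w_mult_sigma_pow a alpha l x).
  assert (Hw := w_pos a alpha l x). assert (Hs := sigma_poly_pos x).
  field. split; [apply pow_nonzero|]; lra.
Qed.

(** * The differential equation *)

Lemma Derive_rodrigues_poly (a alpha : R) (n : nat) (x : R) :
  Derive (rodrigues_poly a alpha n) x =
  - lambda a n * rodrigues_poly a alpha (Nat.pred n) x.
Proof. apply is_derive_unique, is_derive_rodrigues_poly. Qed.

(** Lowering [rodrigues_poly l] brings out the factor [- lambda_l], and what
    remains of the left-hand side is the recurrence that raises
    [rodrigues_poly (l - 1)] back to [rodrigues_poly l]. *)
Theorem theorem1p4 (a alpha : R) (l : nat) :
  is_polynomial (P a alpha l) /\
  forall x : R,
    sigma_poly x * Derive_n (P a alpha l) 2 x
      + tau a alpha l x * Derive (P a alpha l) x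
    = - lambda a l * P a alpha l x.
Proof.
  split.
  { apply is_polynomial_ext with (rodrigues_poly a alpha l).
    - intros x. symmetry. apply P_eq_rodrigues_poly.
    - apply is_polynomial_rodrigues_poly. }
  intros x.
  rewrite (Derive_n_ext _ _ 2 x (P_eq_rodrigues_poly a alpha l)).
  rewrite (Derive_ext _ _ x (P_eq_rodrigues_poly a alpha l)).
  rewrite P_eq_rodrigues_poly.
  unfold tau. rewrite (is_derive_unique _ _ _ (is_derive_sigma_poly x)).
  change (Derive_n (rodrigues_poly a alpha l) 2 x)
    with (Derive (Derive (rodrigues_poly a alpha l)) x).
  rewrite (Derive_ext _ _ x (Derive_rodrigues_poly a alpha l)).
  rewrite Derive_scal, !Derive_rodrigues_poly.
  destruct l as [|n].
  - rewrite lambda_0. ring.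
  - simpl Nat.pred. rewrite (rodrigues_poly_S a alpha n), S_INR. ring.
Qed.
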